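(* Let $d\ge 1$ be an integer and let $\alpha\in(0,1)$. For $\delta>0$, let $$f_\delta(x)=1-e^{-\delta}e^{-|x|^2/2},\qquad x\in\mathbb{R}^d .$$ For every $\xi_0>0$ there exist constants $C>1$ and $\eta\in(0,1)$, depending only on $d,\alpha,\xi_0$, such that for all $\delta>0$ and all $\xi\in\mathbb{R}^d$ satisfying $$\xi_0^2\le |\xi|^2\le \frac{\eta}{\delta},$$ one has $$\frac1C\,|\xi|^{-2\alpha-d}\le \left|\mathcal{F}\left(f_\delta^\alpha-1\right)(\xi)\right|\le C\,|\xi|^{-2\alpha-d}.$$
   Context: The Fourier transform is normalized as $\mathcal{F}\psi(\xi)=\hat\psi(\xi)=\frac{1}{(2\pi)^{d/2}}\int_{\mathbb{R}^d}e^{-ix\cdot\xi}\psi(x)\,dx$. *)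

(* Defs.v *)
From HB Require Import structures.
From mathcomp Require Import all_boot all_order all_algebra.
From mathcomp Require Import all_classical all_reals all_analysis.
From mathcomp Require Import complex.

Set Implicit Arguments.
Unset Strict Implicit.
Unset Printing Implicit Defensive.

Import Order.TTheory GRing.Theory Num.Theory.
Import numFieldNormedType.Exports.

Local Open Scope classical_set_scope.
Local Open Scope ring_scope.
Local Open Scope complex_scope.

(* d-tuples carry the product (Borel) sigma-algebra, which row vectors lack. *)
Notation Rd R d := (d.-tuple (measurableTypeR R)).

Definition dotp (R : realType) (d : nat) (x y : Rd R d) : R :=
  \sum_(i < d) (tnth x i : R) * (tnth y i : R).

(* Euclidean norm; the norm on matrices provided by the library is the sup norm. *)
Definition enorm (R : realType) (d : nat) (x : Rd R d) : R :=
  Num.sqrt (dotp x x).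

Section lebesgue_Rd_succ.
Local Open Scope ereal_scope.
Context (R : realType) (d : nat).

Definition tuple_cons (p : measurableTypeR R * Rd R d) : Rd R d.+1 :=
  [tuple of p.1 :: p.2].

Lemma measurable_tuple_cons : measurable_fun setT tuple_cons.
Proof. exact: measurable_cons. Qed.

Variable mu : {sigma_finite_measure set (Rd R d) -> \bar R}.

(* The image of (Lebesgue measure on R) x mu under R x R^d ~ R^(d+1). *)
Definition lebesgue_succ : set (Rd R d.+1) -> \bar R :=
  pushforward (@lebesgue_measure R \x mu) tuple_cons.

Let lebesgue_succ0 : lebesgue_succ set0 = 0.
Proof. by rewrite /lebesgue_succ /pushforward preimage_set0 measure0. Qed.

Let lebesgue_succ_ge0 A : 0 <= lebesgue_succ A.
Proof. by have mtc := measurable_tuple_cons; exact: measure_ge0. Qed.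

Let lebesgue_succ_sigma_additive : semi_sigma_additive lebesgue_succ.
Proof.
have mtc := measurable_tuple_cons.
exact: (@measure_semi_sigma_additive _ _ _
  (pushforward (@lebesgue_measure R \x mu) tuple_cons)).
Qed.

HB.instance Definition _ := isMeasure.Build _ _ _ lebesgue_succ
  lebesgue_succ0 lebesgue_succ_ge0 lebesgue_succ_sigma_additive.

Let lebesgue_succ_sigma_finite : sigma_finite setT lebesgue_succ.
Proof.
have /sigma_finiteP[F [TF ndF Foo]] := sigma_finiteT (@lebesgue_measure R).
have /sigma_finiteP[G [TG ndG Goo]] := sigma_finiteT mu.
pose uncons (t : Rd R d.+1) : measurableTypeR R * Rd R d :=
  (thead t, [tuple of behead t]).
have consK : cancel tuple_cons uncons.
  by move=> [a t]; congr pair; apply: val_inj.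
have munc : measurable_fun setT uncons.
  apply/measurable_fun_pairP; split; last exact: measurable_behead.
  exact: measurable_tnth.
exists (fun n => uncons @^-1` (F n `*` G n)).
  apply/seteqP; split=> // t _.
  have [n _ Fn] : (\bigcup_n F n) (uncons t).1 by rewrite -TF.
  have [k _ Gk] : (\bigcup_n G n) (uncons t).2 by rewrite -TG.
  exists (maxn n k) => //; split.
    by move: Fn; exact/subsetPset/ndF/leq_maxl.
  by move: Gk; exact/subsetPset/ndG/leq_maxr.
move=> n; have [mF Ffin] := Foo n; have [mG Gfin] := Goo n; split.
  by rewrite -[X in measurable X]setTI; apply: munc => //; exact: measurableX.
rewrite /lebesgue_succ /pushforward (_ : _ @^-1` _ = F n `*` G n).
  by rewrite product_measure1E// lte_mul_pinfty// ge0_fin_numE.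
by rewrite -comp_preimage (_ : uncons \o tuple_cons = id)//; exact/funext.
Qed.

HB.instance Definition _ := Measure_isSigmaFinite.Build _ _ _ lebesgue_succ
  lebesgue_succ_sigma_finite.

End lebesgue_Rd_succ.

Fixpoint lebesgue_Rd (R : realType) (d : nat) :
    {sigma_finite_measure set (Rd R d) -> \bar R} :=
  match d with
  | 0%N => \d_([tuple] : Rd R 0)
  | n.+1 => lebesgue_succ (lebesgue_Rd R n)
  end.

Lemma lebesgue_Rd_box (R : realType) (d : nat)
    (A : 'I_d -> set (measurableTypeR R)) :
  (forall i, measurable (A i)) ->
  lebesgue_Rd R d [set x | forall i, A i (tnth x i)] =
  (\prod_(i < d) lebesgue_measure (A i))%E.
Proof.
elim: d A => [|d IHd] A mA.
  by rewrite big_ord0 /= diracE mem_set//= => -[].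
rewrite big_ord_recl -(IHd (fun i => A (lift ord0 i)))// -product_measure1E//.
  rewrite /= /lebesgue_succ /pushforward; congr (_ _).
  apply/seteqP; split => -[a t] /=.
    move=> H; split; first exact: (H ord0).
    by move=> i /=; have := H (lift ord0 i); rewrite tnthS.
  move=> [a0 tA] i; have [->//|i0] := eqVneq i ord0.
  have [j ->] : exists j, i = lift ord0 j.
    by case: (unliftP ord0 i) i0 => [j ->|->]; [exists j|rewrite eqxx].
  by rewrite tnthS; exact: tA.
rewrite (_ : [set _ | _] =
    \bigcap_(i in [set: 'I_d]) ((@tnth _ _ ^~ i) @^-1` A (lift ord0 i))).
  apply: fin_bigcap_measurable => // i _.
  rewrite -[X in measurable X]setTI; exact: measurable_tnth.
by apply/seteqP; split => [x /= H i _ /=|x /= H i]; exact: H.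
Qed.

Definition Cintegral d (T : measurableType d) (R : realType)
    (mu : {measure set T -> \bar R}) (f : T -> R[i]) : R[i] :=
  (\int[mu]_x complex.Re (f x)) +i* (\int[mu]_x complex.Im (f x)).

(* e^{it} *)
Definition cexpi (R : realType) (t : R) : R[i] := cos t +i* sin t.

Definition fourier (R : realType) (d : nat) (psi : Rd R d -> R[i])
    (xi : Rd R d) : R[i] :=
  (((2 * pi) `^ (d%:R / 2))^-1)%:C *
  Cintegral (lebesgue_Rd R d) (fun x => cexpi (- dotp x xi) * psi x).

Definition fdelta (R : realType) (d : nat) (delta : R) (x : Rd R d) : R :=
  1 - expR (- delta) * expR (- (enorm x ^+ 2 / 2)).

(* Main.v *)
Require Import Defs.
From mathcomp Require Import all_boot all_order all_algebra.
From mathcomp Require Import all_classical all_reals all_analysis.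
From mathcomp Require Import measurable_realfun complex ring lra.

Set Implicit Arguments.
Unset Strict Implicit.
Unset Printing Implicit Defensive.

Import Order.TTheory GRing.Theory Num.Theory.
Import numFieldNormedType.Exports.

Local Open Scope classical_set_scope.
Local Open Scope ring_scope.
Local Open Scope complex_scope.

(** Write z = e^-delta e^(-|x|^2/2), so that f_delta = 1 - z with
    0 < z <= e^-delta < 1.  In the binomial series
      (1 - z)^alpha - 1 = - (sum over m >= 1 of a_m z^m)
    every coefficient a_m is positive, because 0 < alpha < 1, and a_m is
    comparable to m^(-1-alpha) ([binom_coef_le], [binom_coef_ge]).  The power
    z^m is e^(-m delta) times a Gaussian of variance 1/m, so the Fourier
    transform at xi is minus the positive sum
      sum over m of a_m e^(-m delta) m^(-d/2) e^(-|xi|^2/(2m)).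
    All terms have the same sign, so nothing cancels and the absolute value is
    this sum.  With s = |xi|^2 and b = alpha + d/2 its terms are comparable to
    m^(-1-b) e^(-m delta) e^(-s/(2m)); the factor e^(-s/(2m)) suppresses m << s,
    the power suppresses m >> s, and the s or so terms with m of size s add up
    to s^-b = |xi|^(-2 alpha - d).

    Upper bound ([gauss_sum_le]): e^(-y/2) <= C (1 + y)^(-1-b) at y = s/m turns
    the m-th term into at most C (s + m)^(-1-b), and these telescope.  Lower
    bound ([gauss_sum_ge]): the N terms following m = N, with N the integer just
    above s, are each at least a constant times N^(-1-b); the hypothesis
    |xi|^2 <= eta/delta is what keeps e^(-m delta) bounded below there.

    Sum and integral are exchanged with an explicit remainder instead of a
    convergence theorem: the n-th Taylor polynomial of (1 - z)^alpha is off by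
    at most z^(n+1)/(1 - z) ([binom_trunc_error]), whose integral is
    O(e^(-n delta)) for fixed delta ([fourier_approx]).  Real and imaginary
    parts of the integrals are handled together by carrying a phase b in
    cos (b + x . xi): the phase b = 0 is the real part, b = pi/2 the imaginary
    one. *)

(** * The binomial series of (1 - z)^a *)

(** Young's inequality for the product of 1 + x and 1, with exponent p. *)
Lemma bernoulli_powR (R : realType) (p x : R) :
  1 < p -> -1 <= x -> 1 + p * x <= (1 + x) `^ p.
Proof.
move=> p1 x1; have p0 : 0 < p by lra.
have q0 : 0 < p / (p - 1) by rewrite divr_gt0 ?subr_gt0.
have pq : p^-1 + (p / (p - 1))^-1 = 1.
  by field; rewrite !gt_eqF ?subr_gt0.
have x1' : 0 <= 1 + x by lra.
have := conjugate_powR x1' ler01 p0 q0 pq.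
rewrite mulr1 powR1 div1r => /(ler_wpM2l (ltW p0)).
have -> : p * ((1 + x) `^ p / p + (p / (p - 1))^-1) = (1 + x) `^ p + (p - 1).
  by field; rewrite !gt_eqF ?subr_gt0.
lra.
Qed.

(** [binom_coef a k] is minus the coefficient of z^(k+1) in (1 - z)^a, that is
    a (1 - a) (2 - a) ... (k - a) / (k+1)!.  The index is shifted by one because
    the constant term 1 is not negated: every coefficient kept here is positive
    when 0 < a < 1. *)
Definition binom_coef (R : realType) (a : R) (k : nat) : R :=
  a * \prod_(j < k) ((j.+1%:R - a) / j.+2%:R).

Section binomial_coefficients.
Variables (R : realType) (a : R).
Hypotheses (a0 : 0 < a) (a1 : a < 1).

Lemma binom_coef0 : binom_coef a 0 = a.
Proof. by rewrite /binom_coef big_ord0 mulr1. Qed.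

Lemma binom_coefS k : binom_coef a k.+1 = binom_coef a k * ((k.+1%:R - a) / k.+2%:R).
Proof. by rewrite /binom_coef big_ord_recr mulrA. Qed.

Let ka k : 0 < k.+1%:R - a.
Proof. by rewrite subr_gt0 (lt_le_trans a1)// ler1n. Qed.

Lemma binom_coef_gt0 k : 0 < binom_coef a k.
Proof.
rewrite /binom_coef mulr_gt0// prodr_gt0// => j _.
by rewrite divr_gt0.
Qed.

(** The sequence a_m m^(1+a) is nonincreasing: Bernoulli's inequality at
    -1/(m+1) bounds the ratio (m - a)/(m + 1) of consecutive coefficients by
    (m/(m+1))^(1+a). *)
Lemma binom_coef_le k : binom_coef a k <= a * k.+1%:R `^ (- (1 + a)).
Proof.
rewrite powRN ler_pdivlMr ?powR_gt0//.
elim: k => [|k IH]; first by rewrite binom_coef0 powR1 mulr1.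
apply: le_trans IH; rewrite binom_coefS -mulrA ler_wpM2l ?(ltW (binom_coef_gt0 _))//.
have k2 : (0 : R) < k.+2%:R by rewrite ltr0n.
have e : k.+1%:R = (1 + - k.+2%:R^-1) * k.+2%:R :> R.
  by rewrite mulrDl mul1r mulNr mulVf ?gt_eqF// -[k.+2]addn1 natrD addrK.
have h : -1 <= - k.+2%:R^-1 :> R by rewrite lerN2 invf_le1// ler1n.
have h' : 0 <= 1 - k.+2%:R^-1 :> R by rewrite subr_ge0 invf_le1// ler1n.
rewrite [in leRHS]e powRM//.
rewrite ler_wpM2r ?powR_ge0//.
have p1 : 1 < 1 + a by rewrite ltrDl.
apply: le_trans (bernoulli_powR p1 h).
rewrite le_eqVlt; apply/orP; left; apply/eqP.
rewrite -[k.+2]addn1 natrD; field.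
by rewrite -natr1 in k2; rewrite gt_eqF.
Qed.

(** The sequence a_m (m - a)^(1+a) is nondecreasing, by Bernoulli's inequality
    at 1/(m - a); shifting the base by a makes the induction go through, and
    m - a <= m then gives the stated bound. *)
Lemma binom_coef_ge k :
  a * (1 - a) `^ (1 + a) * k.+1%:R `^ (- (1 + a)) <= binom_coef a k.
Proof.
rewrite powRN ler_pdivrMr ?powR_gt0//.
apply: (@le_trans _ _ (binom_coef a k * (k.+1%:R - a) `^ (1 + a))); last first.
  rewrite ler_wpM2l ?(ltW (binom_coef_gt0 _))//
    ge0_ler_powR ?nnegrE ?ler0n ?(ltW (ka _))//.
    by rewrite addr_ge0// ltW.
  by rewrite gerBl ltW.
elim: k => [|k IH]; first by rewrite binom_coef0.
apply: (le_trans IH); rewrite binom_coefS -mulrA ler_wpM2l ?(ltW (binom_coef_gt0 _))//.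
have y0 := ka k; set y := _ - a in y0 *.
have e1 : k.+2%:R = y + (1 + a) by rewrite /y -[in LHS]natr1; ring.
clearbody y.
have -> : k.+2%:R - a = (1 + y^-1) * y.
  rewrite mulrDl mul1r mulVf ?gt_eqF// e1; ring.
have yi : 0 < y^-1 by rewrite invr_gt0.
rewrite powRM ?addr_ge0 ?(ltW y0) ?(ltW yi)//.
rewrite e1 mulrA ler_peMl ?powR_ge0//.
rewrite mulrAC ler_pdivlMr ?mul1r ?addr_gt0//.
have p1 : 1 < 1 + a by rewrite ltrDl.
have yi1 : -1 <= y^-1 by rewrite (le_trans _ (ltW yi))// lerN10.
move: (bernoulli_powR p1 yi1) => /(ler_wpM2l (ltW y0)); apply: le_trans.
rewrite mulrDr mulr1 mulrCA divff ?gt_eqF// mulr1; lra.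
Qed.

End binomial_coefficients.

(** The Taylor polynomial of (1 - z)^a at 0, of degree n. *)
Definition binom_trunc (R : realType) (a : R) (n : nat) (z : R) : R :=
  1 - \sum_(k < n) binom_coef a k * z ^+ k.+1.

Definition binom_trunc_deriv (R : realType) (a : R) (n : nat) (z : R) : R :=
  - \sum_(k < n) binom_coef a k * k.+1%:R * z ^+ k.

Lemma binom_truncS (R : realType) (a : R) n z :
  binom_trunc a n.+1 z = binom_trunc a n z - binom_coef a n * z ^+ n.+1.
Proof. by rewrite /binom_trunc big_ord_recr /= opprD addrA. Qed.

Lemma is_derive_binom_trunc (R : realType) (a : R) n (z : R) :
  is_derive z 1 (binom_trunc a n) (binom_trunc_deriv a n z).
Proof.
elim: n => [|n IH].
  rewrite (_ : binom_trunc a 0 = cst 1); last first.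
    by apply/funext => x; rewrite /binom_trunc big_ord0 subr0.
  by rewrite /binom_trunc_deriv big_ord0 oppr0; exact: is_derive_cst.
rewrite (_ : binom_trunc a n.+1 = binom_trunc a n -
    (binom_coef a n \*: (id ^+ n.+1 : R -> R))); last first.
  by apply/funext => x; rewrite binom_truncS !fctE.
rewrite /binom_trunc_deriv big_ord_recr /= opprD -/(binom_trunc_deriv a n z).
apply: is_derive_eq.
by rewrite /GRing.scale /= mulr1 mulrA.
Qed.

(** The function (1 - z)^a solves (1 - z) y' + a y = 0; its Taylor polynomial
    leaves only the monomial of top degree. *)
Lemma binom_trunc_ode (R : realType) (a : R) n (z : R) :
  (1 - z) * binom_trunc_deriv a n z + a * binom_trunc a n z =
  n.+1%:R * binom_coef a n * z ^+ n.
Proof.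
elim: n => [|n IH].
  by rewrite /binom_trunc_deriv /binom_trunc !big_ord0 binom_coef0; ring.
rewrite binom_truncS /binom_trunc_deriv big_ord_recr /= opprD.
rewrite -/(binom_trunc_deriv a n z) mulrDr mulrBr addrACA IH.
rewrite binom_coefS exprS.
rewrite [n.+2%:R * _]mulrCA [n.+2%:R * _]mulrCA divff ?pnatr_eq0// mulr1.
ring.
Qed.

(** By [binom_trunc_ode] the quotient h of the Taylor polynomial by (1 - z)^a has
    derivative (n+1) a_(n+1) z^n (1 - z)^(-a-1), where (n+1) a_(n+1) <= 1, and
    h 0 = 1.  The mean value theorem on [0, z] bounds h z - 1. *)
Lemma binom_trunc_error (R : realType) (a : R) n (z : R) : 0 < a -> a < 1 ->
  0 <= z -> z < 1 ->
  0 <= binom_trunc a n z - (1 - z) `^ a <= z ^+ n.+1 / (1 - z).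
Proof.
move=> a0 a1 z0 z1.
pose h (x : R) := binom_trunc a n x * (1 - x) `^ (- a).
pose dh (x : R) := n.+1%:R * binom_coef a n * x ^+ n * (1 - x) `^ (- a - 1).
have dH (x : R) : x < 1 -> is_derive x 1 h (dh x).
  move=> x1.
  have H1 := is_derive_binom_trunc a n x.
  have y0 : 0 < 1 - x by rewrite subr_gt0.
  have H2 : is_derive x 1 (fun x : R => (1 - x) `^ (- a)) (a * (1 - x) `^ (- a - 1)).
    have P : is_derive (1 - x) 1 (@powR R ^~ (- a)) ((- a) * (1 - x) `^ (- a - 1)).
      exact: is_derive1_powR.
    have Q : is_derive x 1 (fun x : R => 1 - x) (-1).
      rewrite -[X in is_derive _ _ _ X]sub0r.
      rewrite (_ : (fun y : R => 1 - y) = cst (1 : R) - id); last exact/funext.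
      exact: is_deriveB.
    have := @is_derive1_comp _ (@powR R ^~ (- a)) (fun x : R => 1 - x) x _ _ P Q.
    by rewrite mulrN1 mulNr opprK.
  apply: is_derive_eq.
  rewrite /GRing.scale /= /dh -binom_trunc_ode.
  have -> : (1 - x) `^ (- a) = (1 - x) * (1 - x) `^ (- a - 1).
    rewrite -{2}[1 - x]powRr1 ?ltW// -powRD ?(gt_eqF y0) ?implybT//.
    by congr (_ `^ _); ring.
  ring.
have hc : {within `[0, z], continuous h}.
  apply: derivable_within_continuous => x; rewrite in_itv/= => /andP[_ xz].
  by have [] := dH x (le_lt_trans xz z1).
have dh' (x : R) : x \in `]0, z[ -> is_derive x 1 h (dh x).
  by rewrite in_itv/= => /andP[_ xz]; exact: dH (lt_trans xz z1).
have [c] := MVT_segment z0 dh' hc.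
rewrite in_itv /= => /andP[c0 cz].
have h0 : h 0 = 1.
  rewrite /h /binom_trunc subr0 powR1 mulr1 big1 ?subr0// => i _.
  by rewrite expr0n mulr0.
have pz : 0 < 1 - z by rewrite subr_gt0.
rewrite h0 subr0 => hz.
have E : binom_trunc a n z - (1 - z) `^ a = (h z - 1) * (1 - z) `^ a.
  rewrite mulrBl mul1r /h -mulrA -powRD ?addNr ?powRr0 ?mulr1//.
  by rewrite eqxx gt_eqF.
have bn : n.+1%:R * binom_coef a n <= 1.
  apply: (@le_trans _ _ (n.+1%:R * (a * n.+1%:R `^ (- (1 + a))))).
    by rewrite ler_wpM2l// binom_coef_le.
  rewrite powRN mulrCA -[leRHS]mulr1 ler_pM ?(ltW a0) ?(ltW a1)//
    ?mulr_ge0 ?invr_ge0 ?powR_ge0//.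
  by rewrite ler_pdivrMr ?powR_gt0// mul1r le1r_powR ?ler1n ?lerDl ?(ltW a0).
have bn0 : 0 <= n.+1%:R * binom_coef a n.
  by rewrite mulr_ge0 ?(ltW (binom_coef_gt0 a0 a1 _)).
have pc : 0 < 1 - c by rewrite subr_gt0 (le_lt_trans cz).
rewrite E hz /dh; apply/andP; split.
  rewrite mulr_ge0 ?powR_ge0// mulr_ge0// mulr_ge0 ?powR_ge0//.
  by rewrite mulr_ge0 ?exprn_ge0.
have -> : n.+1%:R * binom_coef a n * c ^+ n * (1 - c) `^ (- a - 1) * z * (1 - z) `^ a =
   (n.+1%:R * binom_coef a n) * (c ^+ n * z) *
   ((1 - c) `^ (- a - 1) * (1 - z) `^ a) by ring.
rewrite -[z ^+ n.+1]mul1r exprSr.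
have -> : (1 - z)^-1 = (1 - z) `^ (- a - 1) * (1 - z) `^ a.
  rewrite -powRD ?(gt_eqF pz) ?implybT// -powR_inv1 ?ltW//; congr (_ `^ _); ring.
have cz0 : 0 <= c ^+ n * z by rewrite mulr_ge0 ?exprn_ge0.
have pp x : 0 <= (1 - x) `^ (- a - 1) * (1 - z) `^ a by rewrite mulr_ge0 ?powR_ge0.
apply: ler_pM => //; first exact: mulr_ge0.
  apply: ler_pM => //; apply: ler_pM; rewrite ?exprn_ge0//.
  by rewrite lerXn2r ?nnegrE.
rewrite ler_wpM2r ?powR_ge0//.
rewrite -opprD !powRN lef_pV2 ?posrE ?powR_gt0//.
by rewrite ge0_ler_powR ?nnegrE ?(ltW pz) ?(ltW pc) ?lerD2l ?lerN2 ?addr_ge0 ?(ltW a0).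
Qed.

(** * Sums of Gaussian weights *)

Section shifted_sums.
Variables (R : realType) (b : R).
Hypothesis b0 : 0 < b.

(** Exponential decay beats the power 1 + b: with p = 1 + b, this is the tangent
    line bound on ln at 2p, applied to ln (1 + y). *)
Lemma expR_le_powR_inv : exists2 C : R, 0 < C &
  forall y : R, 0 <= y -> expR (- (y / 2)) <= C * (1 + y) `^ (- (1 + b)).
Proof.
pose p := 1 + b.
have p0 : 0 < p by rewrite addr_gt0.
exists (expR (p * ln (2 * p) + 2^-1)); first exact: expR_gt0.
move=> y y0; have y1 : 0 < 1 + y by rewrite ltr_pwDl.
rewrite /powR gt_eqF// -expRD ler_expR -/p.
have p2 : 0 < 2 * p by rewrite mulr_gt0.
have q0 : 0 < (1 + y) / (2 * p) by rewrite divr_gt0.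
have : ln (1 + y) <= ln (2 * p) + (1 + y) / (2 * p) - 1.
  have {1}-> : 1 + y = (2 * p) * ((1 + y) / (2 * p)).
    by rewrite mulrCA divff ?mulr1// gt_eqF.
  rewrite lnM ?posrE// -addrA lerD2l.
  have := @le_ln1Dx R ((1 + y) / (2 * p) - 1).
  rewrite [1 + (_ - _)]addrC subrK; apply.
  by rewrite ltrDr.
move=> /(ler_wpM2l (ltW p0)).
have -> : p * (ln (2 * p) + (1 + y) / (2 * p) - 1) = p * ln (2 * p) + (1 + y) / 2 - p.
  by field; rewrite gt_eqF.
rewrite mulNr; move: (p * ln (1 + y)) (p * ln (2 * p)) => u v.
lra.
Qed.

(** The discrete form of integrating x^(-1-b): after division by (x+1)^-b it
    reads 1 + b/(x+1) <= (x/(x+1))^-b, from ln u <= u - 1 and 1 + u <= e^u. *)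
Lemma powR_telescope (x : R) : 0 < x ->
  (x + 1) `^ (- (1 + b)) <= b^-1 * (x `^ (- b) - (x + 1) `^ (- b)).
Proof.
move=> x0; have x1 : 0 < x + 1 by rewrite addr_gt0.
rewrite ler_pdivlMl// lerBrDr opprD addrC.
rewrite powRD; last by rewrite (gt_eqF x1) implybT.
rewrite powR_inv1 ?(ltW x1)// mulrA -{1}[_ `^ _]mul1r -mulrDl.
have -> : x `^ (- b) = expR (- b * ln (x / (x + 1))) * (x + 1) `^ (- b).
  rewrite {2}/powR gt_eqF// -expRD -mulrDr -lnM ?posrE ?divr_gt0//.
  by rewrite divfK ?gt_eqF// /powR gt_eqF.
rewrite ler_wpM2r ?powR_ge0//; apply: le_trans (expR_ge1Dx _).
rewrite lerD2l mulNr -mulrN ler_wpM2l ?(ltW b0)// lerNr.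
have -> : x / (x + 1) = 1 + (- (x + 1)^-1) by field; rewrite gt_eqF.
by apply: le_ln1Dx; rewrite ltrN2 invf_lt1// ltrDr.
Qed.

Lemma sum_shifted_le (s : R) n : 0 < s ->
  \sum_(k < n) (s + k.+1%:R) `^ (- (1 + b)) <= b^-1 * s `^ (- b).
Proof.
move=> s0; apply: (@le_trans _ _ (b^-1 * (s `^ (- b) - (s + n%:R) `^ (- b)))).
  elim: n => [|n IH]; first by rewrite big_ord0 addr0 subrr mulr0.
  rewrite big_ord_recr /=.
  have sn : 0 < s + n%:R by rewrite ltr_wpDr.
  have := powR_telescope sn; rewrite -addrA natr1 => H.
  apply: le_trans (lerD IH H) _; rewrite -mulrDr addrA subrK //.
by rewrite ler_wpM2l ?invr_ge0 ?(ltW b0)// gerBl powR_ge0.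
Qed.

End shifted_sums.

Section gauss_sums.
Variables (R : realType) (a h : R).
Hypotheses (a0 : 0 < a) (a1 : a < 1) (h0 : 0 <= h).

(** With s = |xi|^2 and h = d/2, [gauss_term delta s k] is, up to the factor
    - (2 pi)^(d/2), the integral of cos (x . xi) against the (k+1)-st term of the
    binomial series of f_delta^a. *)
Definition gauss_term (delta s : R) (k : nat) : R :=
  binom_coef a k * expR (- (k.+1%:R * delta)) *
  (k.+1%:R `^ (- h) * expR (- (s / k.+1%:R / 2))).

Definition gauss_sum (delta s : R) (n : nat) : R := \sum_(k < n) gauss_term delta s k.

Lemma gauss_term_ge0 delta s k : 0 <= gauss_term delta s k.
Proof.
have bk := ltW (binom_coef_gt0 a0 a1 k).
by rewrite /gauss_term; apply: mulr_ge0; apply: mulr_ge0; rewrite ?expR_ge0 ?powR_ge0.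
Qed.

Let ha0 : 0 < a + h. Proof. by rewrite ltr_pwDl. Qed.

(** Uniform in delta, since e^(-m delta) <= 1.  Bounding e^(-s/(2m)) by a power
    of 1 + s/m merges it with m^(-1-a-h) into (s + m)^(-1-a-h), so that the sizes
    m <= s and m >= s need no separate treatment. *)
Lemma gauss_sum_le : exists2 C : R, 0 < C & forall (delta s : R) n, 0 < delta -> 0 < s ->
  gauss_sum delta s n <= C * s `^ (- (a + h)).
Proof.
have [C C0 HC] := expR_le_powR_inv ha0.
exists (a * C / (a + h)); first by rewrite divr_gt0 ?mulr_gt0.
move=> delta s n d0 s0.
rewrite -[_ / _ * _]mulrA; apply: le_trans (ler_wpM2l _ (sum_shifted_le ha0 n s0)).
  rewrite mulr_sumr; apply: ler_sum => k _.
  have k0 : (0 : R) < k.+1%:R by rewrite ltr0n.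
  have -> : s + k.+1%:R = (1 + s / k.+1%:R) * k.+1%:R.
    by rewrite mulrDl mul1r divfK ?gt_eqF// addrC.
  rewrite powRM ?addr_ge0 ?divr_ge0 ?(ltW s0)//.
  have e1 : expR (- (k.+1%:R * delta)) <= 1.
    by rewrite -expR0 ler_expR oppr_le0 mulr_ge0 ?ltW.
  have e2 := HC (s / k.+1%:R) (divr_ge0 (ltW s0) (ltW k0)).
  have e3 := binom_coef_le a0 a1 k.
  rewrite /gauss_term.
  apply: (@le_trans _ _ ((a * k.+1%:R `^ (- (1 + a))) * 1 * (k.+1%:R `^ (- h) *
    (C * (1 + s / k.+1%:R) `^ (- (1 + (a + h))))))).
    apply: ler_pM.
    - by apply: mulr_ge0 (expR_ge0 _); exact: ltW (binom_coef_gt0 a0 a1 _).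
    - by rewrite mulr_ge0 ?expR_ge0 ?powR_ge0.
    - by apply: ler_pM; rewrite ?expR_ge0 ?(ltW (binom_coef_gt0 a0 a1 _)).
    - by rewrite ler_wpM2l ?powR_ge0.
  have -> : - (1 + (a + h)) = - (1 + a) + - h by ring.
  rewrite [in leRHS](powRD (x := k.+1%:R)) ?(gt_eqF k0) ?implybT//.
  rewrite le_eqVlt; apply/orP; left; apply/eqP; ring.
by rewrite mulr_ge0// ltW.
Qed.

(** Only the terms m = k + 1 with N <= k < 2N are kept, N being the integer just
    above s.  There s <= m gives e^(-s/(2m)) >= e^(-1/2), and N <= K s with
    K = 1 + 1/s0 together with s delta <= 1/2 gives e^(-m delta) >= e^-K. *)
Lemma gauss_sum_ge (s0 : R) : 0 < s0 -> exists2 c : R, 0 < c &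
  forall delta s : R, 0 < delta -> s0 <= s -> s <= 2^-1 / delta ->
  exists n0, forall n, (n0 <= n)%N -> c * s `^ (- (a + h)) <= gauss_sum delta s n.
Proof.
move=> s00.
(* K, b and c1 are made abstract: rewriting with the positivity lemmas would
   otherwise unfold them. *)
have [K KE] : exists K, K = 1 + s0^-1 by exists (1 + s0^-1).
have K0 : 0 < K by rewrite KE addr_gt0 ?invr_gt0.
have [b bE] : exists b, b = a + h by exists (a + h).
have b0 : 0 < b by rewrite bE.
have [c1 c10 c1_le] : exists2 c1 : R, 0 < c1 &
    forall k, c1 * k.+1%:R `^ (- (1 + a)) <= binom_coef a k.
  exists (a * (1 - a) `^ (1 + a)); last exact: binom_coef_ge.
  by apply: mulr_gt0 (powR_gt0 _ _) => //; rewrite subr_gt0.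
exists (c1 * 2 `^ (- (1 + b)) * expR (- K) * expR (- 2^-1) * K `^ (- b)).
  by rewrite !mulr_gt0 ?expR_gt0 ?powR_gt0.
move=> delta s d0 s0s sd; rewrite -bE.
have sp : 0 < s by exact: lt_le_trans s0s.
pose N := (Num.truncn s).+1.
have sN : s < N%:R by exact: truncnS_gt.
have NK : N%:R <= K * s.
  rewrite -natr1 KE mulrDl mul1r [s + _]addrC [_ + 1]addrC.
  by apply: lerD; [rewrite ler_pdivlMl// mulr1|rewrite truncn_le// ltW].
have Np : (0 : R) < N%:R by rewrite ltr0n.
have Nd : N%:R * delta <= K / 2.
  apply: (@le_trans _ _ (K * s * delta)); first by rewrite ler_wpM2r// ltW.
  rewrite -mulrA ler_wpM2l ?(ltW K0)//.
  by rewrite -ler_pdivlMr.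
exists (N + N)%N => n nN.
pose t := c1 * (2 * N%:R) `^ (- (1 + b)) * expR (- K) * expR (- 2^-1).
have t0 : 0 <= t by rewrite !mulr_ge0 ?expR_ge0 ?powR_ge0 ?(ltW c10).
have Ht k : (N <= k < N + N)%N -> t <= gauss_term delta s k.
  move=> /andP[Nk kN].
  have k0 : (0 : R) < k.+1%:R by rewrite ltr0n.
  have kN' : (k.+1%:R : R) <= 2 * N%:R.
    by rewrite mulr_natl mulr2n -natrD ler_nat.
  have sk : s <= k.+1%:R.
    by rewrite (le_trans (ltW sN))// ler_nat leqW.
  apply: (@le_trans _ _ (c1 * k.+1%:R `^ (- (1 + a)) * expR (- K) *
     (k.+1%:R `^ (- h) * expR (- 2^-1)))).
    have -> : c1 * k.+1%:R `^ (- (1 + a)) * expR (- K) *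
     (k.+1%:R `^ (- h) * expR (- 2^-1)) =
     c1 * k.+1%:R `^ (- (1 + b)) * expR (- K) * expR (- 2^-1).
      have -> : - (1 + b) = - (1 + a) + - h by rewrite bE; ring.
      rewrite (powRD (x := k.+1%:R)) ?(gt_eqF k0) ?implybT//; ring.
    rewrite /t !ler_wpM2r ?expR_ge0// ler_wpM2l ?(ltW c10)//.
    rewrite !powRN lef_pV2 ?posrE ?powR_gt0 ?mulr_gt0//.
    by rewrite ge0_ler_powR ?nnegrE ?mulr_ge0 ?addr_ge0 ?(ltW b0).
  rewrite /gauss_term; apply: ler_pM.
  - by rewrite !mulr_ge0 ?expR_ge0 ?powR_ge0 ?(ltW c10).
  - by rewrite !mulr_ge0 ?expR_ge0 ?powR_ge0.
  - apply: ler_pM.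
    + by rewrite mulr_ge0 ?powR_ge0 ?(ltW c10).
    + exact: expR_ge0.
    + exact: c1_le.
    + rewrite ler_expR lerN2 (@le_trans _ _ (2 * N%:R * delta)) ?ler_wpM2r ?(ltW d0)//.
      by rewrite -mulrA -ler_pdivlMl// [leRHS]mulrC.
  - rewrite ler_wpM2l ?powR_ge0// ler_expR lerN2 -[leRHS]mul1r ler_wpM2r//.
    by rewrite ler_pdivrMr// mul1r.
apply: (@le_trans _ _ (t *+ N)).
  rewrite -[t *+ N]mulr_natr /t.
  have -> : (2 * N%:R) `^ (- (1 + b)) = 2 `^ (- (1 + b)) * (N%:R^-1 * N%:R `^ (- b)).
    rewrite powRM//; congr (_ * _).
    by rewrite -powR_inv1// -powRD ?(gt_eqF Np) ?implybT// -opprD.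
  have NN : N%:R^-1 * N%:R = 1 :> R by rewrite mulVf// gt_eqF.
  have -> : c1 * (2 `^ (- (1 + b)) * (N%:R^-1 * N%:R `^ (- b))) * expR (- K) *
      expR (- 2^-1) * N%:R =
      c1 * 2 `^ (- (1 + b)) * expR (- K) * expR (- 2^-1) * N%:R `^ (- b) *
      (N%:R^-1 * N%:R) by ring.
  rewrite NN mulr1 -[leLHS]mulrA ler_wpM2l//.
    by rewrite !mulr_ge0 ?expR_ge0 ?powR_ge0 ?(ltW c10).
  rewrite -powRM ?(ltW K0) ?(ltW sp)//.
  rewrite !powRN lef_pV2 ?posrE ?powR_gt0 ?mulr_gt0//.
  by rewrite ge0_ler_powR ?nnegrE ?mulr_ge0 ?(ltW K0) ?(ltW sp) ?(ltW b0).
rewrite /gauss_sum -(big_mkord predT (gauss_term delta s)).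
rewrite (big_cat_nat _ (n := N + N)%N)//=.
rewrite [X in _ <= X + _](big_cat_nat _ (n := N))//= ?leq_addr//.
have P i j : 0 <= \sum_(i <= k < j) gauss_term delta s k.
  by apply: sumr_ge0 => k _; exact: gauss_term_ge0.
apply: (@le_trans _ _ (\sum_(N <= k < N + N) gauss_term delta s k)).
  rewrite big_nat.
  apply: le_trans (ler_sum _ Ht).
  by rewrite -big_nat sumr_const_nat addnK.
by rewrite -[leLHS]add0r -[leLHS]addr0 !lerD.
Qed.

End gauss_sums.

(** * The Gaussian integral with a phase on the line *)

Section integrable_EFin.
Context d (T : measurableType d) (R : realType) (mu : {measure set T -> \bar R}).
Implicit Types f g : T -> R.

Lemma integrable_EFinZ (c : R) f : mu.-integrable setT (EFin \o f) ->
  mu.-integrable setT (EFin \o (fun x => c * f x)).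
Proof.
move=> intf.
rewrite (_ : EFin \o _ = (fun x => c%:E * (f x)%:E)%E); last exact/funext.
exact: integrableZl.
Qed.

Lemma integrable_EFinD f g : mu.-integrable setT (EFin \o f) ->
  mu.-integrable setT (EFin \o g) ->
  mu.-integrable setT (EFin \o (fun x => f x + g x)).
Proof.
move=> intf intg.
rewrite (_ : EFin \o _ = (fun x => (f x)%:E + (g x)%:E)%E); last exact/funext.
exact: integrableD.
Qed.

End integrable_EFin.

(** Fundamental theorem of calculus on [-n, n], then dominated convergence. *)
Lemma Rintegral_derivative0 (R : realType) (F f : R -> R) :
  (forall x : R, is_derive x 1 F (f x)) -> continuous f ->
  (@lebesgue_measure R).-integrable setT (EFin \o f) ->
  F n.+1%:R @[n --> \oo] --> 0 -> F (- n.+1%:R) @[n --> \oo] --> 0 ->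
  \int[@lebesgue_measure R]_x f x = 0.
Proof.
move=> dF cf intf Fp Fm; pose mu : {measure set _ -> \bar R} := @lebesgue_measure R.
pose D n : set R := `[- n.+1%:R, n.+1%:R]%classic.
pose f_ n x : \bar R := ((f \_ (D n)) x)%:E.
have mf : measurable_fun setT f by exact: continuous_measurable_fun.
have I1 : (\int[mu]_x f_ n x)%E @[n --> \oo] --> (\int[mu]_x (f x)%:E)%E.
  apply: (@dominated_cvg _ _ _ mu setT measurableT f_ (EFin \o f) (fun x => `|f x|%:E)).
  - move=> n; apply/measurable_EFinP.
    apply/(measurable_restrictT f); first exact: measurable_itv.
    exact: measurable_funTS.
  - move=> x _; apply: cvg_near_cst.
    near=> n; rewrite /f_ patchE mem_set// /D /= in_itv /= -ler_norml.
    by rewrite (@le_trans _ _ n%:R) ?ler_nat//; near: n; exact: nbhs_infty_ger.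
  - by [].
  - exact: integrable_abse intf.
  - move=> n x _; rewrite /f_ /= lee_fin patchE; case: ifP => // _.
    by rewrite normr0.
have I2 n : (\int[mu]_x f_ n x)%E = (F n.+1%:R - F (- n.+1%:R))%:E.
  rewrite /f_.
  transitivity (\int[mu]_(x in D n) (f x)%:E)%E.
    by rewrite [RHS]integral_mkcond restrict_EFin.
  rewrite EFinB; apply: continuous_FTC2.
  - by rewrite gtrN.
  - exact: continuous_subspaceT.
  - split => [x _||]; first by have [] := dF x.
    + apply: cvg_at_right_filter; apply: differentiable_continuous.
      by apply/derivable1_diffP; have [] := dF (- n.+1%:R).
    + apply: cvg_at_left_filter; apply: differentiable_continuous.
      by apply/derivable1_diffP; have [] := dF n.+1%:R.
  - by move=> x _; rewrite derive1E; have [] := dF x.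
have I3 : (\int[mu]_x f_ n x)%E @[n --> \oo] --> 0%:E.
  under eq_fun do rewrite I2.
  by apply: cvg_EFin; [exact: nearW|rewrite -[X in _ --> X](subrr 0); exact: cvgB].
by rewrite /Rintegral (cvg_unique _ I1 I3).
Unshelve. all: by end_near. Qed.

Definition gauss (R : realType) (a x : R) : R := expR (- (a * (x ^+ 2 / 2))).

Section gaussian.
Variables (R : realType) (a : R).
Hypothesis a0 : 0 < a.
Let mu : {measure set _ -> \bar R} := @lebesgue_measure R.

(** The total mass comes from the normal density of variance 1/a. *)
Let gaussE : gauss a = (fun x => (normal_peak (Num.sqrt a^-1))^-1 *
   normal_pdf 0 (Num.sqrt a^-1) x).
Proof.
have s0 : Num.sqrt a^-1 != 0 by rewrite gt_eqF// sqrtr_gt0 invr_gt0.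
apply/funext => x; rewrite normal_pdfE// mulrA mulVf ?mul1r; last first.
  by rewrite gt_eqF// normal_peak_gt0.
rewrite /normal_fun subr0 sqr_sqrtr ?invr_ge0 ?(ltW a0)// /gauss; congr expR.
by rewrite -mulr_natr; field; rewrite gt_eqF.
Qed.

Lemma integrable_gauss : mu.-integrable setT (EFin \o gauss a).
Proof.
rewrite gaussE.
by apply: integrable_EFinZ; exact: integrable_normal_pdf.
Qed.

Lemma Rintegral_gauss : \int[mu]_x gauss a x = Num.sqrt (2 * pi / a).
Proof.
rewrite gaussE RintegralZl//; last exact: integrable_normal_pdf.
rewrite /Rintegral integral_normal_pdf mulr1 /normal_peak invrK; congr Num.sqrt.
by rewrite sqr_sqrtr ?invr_ge0 ?(ltW a0)// -mulr_natr; ring.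
Qed.

(** Half of the exponent absorbs the factor |x|, since
    |x| <= a x^2/4 + 1/a by the arithmetic-geometric inequality. *)
Lemma normr_gauss_le x : `|x| * gauss a x <= (a^-1 + 1) * gauss (a / 2) x.
Proof.
have ai : 0 < a^-1 by rewrite invr_gt0.
pose y := a / 2 * (x ^+ 2 / 2).
have y0 : 0 <= y by rewrite mulr_ge0 ?divr_ge0 ?sqr_ge0// ltW.
have -> : gauss a x = expR (- y) * expR (- y).
  by rewrite -expRD /gauss /y; congr expR; field.
rewrite mulrA -/(gauss (a / 2) x) /gauss -/y ler_wpM2r ?expR_ge0//.
rewrite expRN ler_pdivrMr ?expR_gt0//.
apply: (@le_trans _ _ ((a^-1 + 1) * (1 + y))); last first.
  by rewrite ler_wpM2l ?expR_ge1Dx// addr_ge0// ltW.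
have : 0 <= a^-1 * (a * `|x| / 2 - 1) ^+ 2 by rewrite mulr_ge0 ?sqr_ge0// ltW.
have -> : a^-1 * (a * `|x| / 2 - 1) ^+ 2 = y + a^-1 - `|x|.
  by rewrite /y -(real_normK (num_real x)); field; rewrite gt_eqF.
rewrite subr_ge0 => /le_trans; apply.
rewrite mulrDl mul1r mulrDr mulr1 [leRHS]addrC lerD//; first by rewrite lerDr.
by rewrite lerDl mulr_ge0// ltW.
Qed.

Lemma measurable_cos_shift (b t : R) :
  measurable_fun setT (fun x : R => cos (b + x * t)).
Proof.
apply: measurableT_comp; first exact: continuous_measurable_fun (@continuous_cos R).
by apply: measurable_funD => //; exact: measurable_funM.
Qed.

Lemma measurable_sin_shift (b t : R) :
  measurable_fun setT (fun x : R => sin (b + x * t)).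
Proof.
apply: measurableT_comp; first exact: continuous_measurable_fun (@continuous_sin R).
by apply: measurable_funD => //; exact: measurable_funM.
Qed.

Lemma measurable_gauss : measurable_fun setT (gauss a).
Proof. by have /measurable_int/measurable_EFinP := integrable_gauss. Qed.

End gaussian.

Section gauss_fourier.
Variables (R : realType) (a : R).
Hypothesis a0 : 0 < a.
Let mu : {measure set _ -> \bar R} := @lebesgue_measure R.

Lemma integrable_cos_gauss b t :
  mu.-integrable setT (EFin \o (fun x => cos (b + x * t) * gauss a x)).
Proof.
apply: (le_integrable _ _ _ (integrable_gauss a0)) => //.
  apply/measurable_EFinP; apply: measurable_funM.
    exact: measurable_cos_shift.
  exact: measurable_gauss.
move=> x _ /=; rewrite lee_fin normrM [`|gauss a x|]ger0_norm ?expR_ge0//.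
by rewrite ler_piMl ?expR_ge0// ler_norml cos_geN1 cos_le1.
Qed.

Lemma integrable_id_gauss : mu.-integrable setT (EFin \o (fun x => `|x| * gauss a x)).
Proof.
have a2 : 0 < a / 2 by rewrite divr_gt0.
have ig := integrable_EFinZ (a^-1 + 1) (integrable_gauss a2).
apply: (le_integrable _ _ _ ig) => //.
  apply/measurable_EFinP; apply: measurable_funM; last exact: measurable_gauss.
  exact: normr_measurable.
move=> x _ /=; rewrite lee_fin [leRHS]ger0_norm.
  by rewrite normrM normr_id [`|gauss a x|]ger0_norm ?expR_ge0// normr_gauss_le.
by rewrite mulr_ge0 ?expR_ge0 ?addr_ge0 ?invr_ge0 ?(ltW a0).
Qed.

Lemma integrable_sin_gauss b t :
  mu.-integrable setT (EFin \o (fun x => sin (b + x * t) * x * gauss a x)).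
Proof.
apply: (le_integrable _ _ _ integrable_id_gauss) => //.
  apply/measurable_EFinP; apply: measurable_funM; last exact: measurable_gauss.
  by apply: measurable_funM => //; exact: measurable_sin_shift.
move=> x _ /=; rewrite lee_fin !normrM normr_id.
by rewrite ler_wpM2r// ler_piMl// ler_norml sin_geN1 sin_le1.
Qed.

Let phi b t := \int[mu]_x (cos (b + x * t) * gauss a x).
Let phi' b t := \int[mu]_x (- (sin (b + x * t) * x * gauss a x)).

(** Differentiation under the integral, dominated by |x| times the Gaussian. *)
Lemma is_derive_gauss_phase (b t : R) : is_derive t 1 (phi b) (phi' b t).
Proof.
pose f (t x : R) := cos (b + x * t) * gauss a x.
have df (x s : R) : is_derive s 1 (f ^~ x) (- (sin (b + x * s) * x * gauss a x)).
  have P : is_derive s 1 (fun s : R => b + x * s) x.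
    rewrite (_ : (fun s : R => b + x * s) = cst b + x \*: id); last exact/funext.
    by apply: is_derive_eq; rewrite add0r /GRing.scale /= mulr1.
  have Q := @is_derive1_comp _ (@cos R) (fun s : R => b + x * s) s _ _
    (is_derive_cos _) P.
  rewrite (_ : f ^~ x = (gauss a x) \*: (@cos R \o (fun s : R => b + x * s))); last first.
    by apply/funext => y; rewrite /f /= mulrC.
  by apply: is_derive_eq; rewrite /GRing.scale /=; ring.
have d1 s x : partial1of2 f s x = - (sin (b + x * s) * x * gauss a x).
  by rewrite partial1of2E; have [] := df x s.
have It : `]t - 1, t + 1[%classic t by rewrite /= in_itv /= ltrBlDr !ltrDl ltr01.
have H1 s : `]t - 1, t + 1[%classic s -> mu.-integrable setT (EFin \o f s).
  by move=> _; exact: integrable_cos_gauss.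
have H2 s x : `]t - 1, t + 1[%classic s -> [set: R] x -> derivable (f ^~ x) s 1.
  by move=> _ _; have [] := df x s.
have H3 (y : R) : 0 <= `|y| * gauss a y by rewrite mulr_ge0 ?expR_ge0.
have H4 s x : `]t - 1, t + 1[%classic s -> [set: R] x ->
    `|partial1of2 f s x| <= `|x| * gauss a x.
  move=> _ _; rewrite d1 normrN !normrM [`|gauss a x|]ger0_norm ?expR_ge0//.
  by rewrite ler_wpM2r ?expR_ge0// ler_piMl// ler_norml sin_geN1 sin_le1.
apply: DeriveDef.
  exact: (@derivable_under_integral _ _ _ mu f setT measurableT t _ _ It H1 H2
    _ H3 integrable_id_gauss H4).
rewrite -derive1E (@differentiation_under_integral _ _ _ mu f setT measurableT
  t _ _ It H1 H2 _ H3 integrable_id_gauss H4).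
by apply: eq_Rintegral => x _; rewrite d1.
Qed.


Lemma gauss_cvg0 (F : R -> R) : (forall x, `|F x| <= gauss a x) ->
  F n.+1%:R @[n --> \oo] --> 0 /\ F (- n.+1%:R) @[n --> \oo] --> 0.
Proof.
move=> HF.
have G : gauss a n.+1%:R @[n --> \oo] --> 0.
  apply: (@squeeze_cvgr _ _ _ _ (cst 0) (fun n => (2 / a) * n.+1%:R^-1)).
  - apply: nearW => n; rewrite expR_ge0 /=.
    have n0 : (0 : R) < n.+1%:R by rewrite ltr0n.
    rewrite /gauss expRN -[leRHS]invrK.
    rewrite lef_pV2 ?posrE ?expR_gt0 ?invr_gt0 ?mulr_gt0 ?invr_gt0//.
    apply: le_trans (expR_ge1Dx _); rewrite invfM invrK invf_div.
    rewrite (@le_trans _ _ (a * (n.+1%:R ^+ 2 / 2)))// ?lerDr//.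
    rewrite mulrAC -mulrA ler_wpM2l ?(ltW a0)// ler_wpM2r// expr2 ler_peMl ?(ltW n0)//.
    by rewrite ler1n.
  - exact: cvg_cst.
  - rewrite -[X in _ --> X](mulr0 (2 / a)); apply: cvgMl_tmp.
    exact: cvg_harmonic.
have E x : gauss a (- x) = gauss a x by rewrite /gauss sqrrN.
split; apply: norm_cvg0; apply: (@squeeze_cvgr _ _ _ _ (cst 0) _ _ _ _ _ G).
- by apply: nearW => n; rewrite normr_ge0 HF.
- exact: cvg_cst.
- by apply: nearW => n; rewrite normr_ge0 (le_trans (HF _))// E.
- exact: cvg_cst.
Qed.

(** Integration by parts: the derivative of sin (b + x t) e^(-a x^2/2) in x
    integrates to 0. *)
Lemma gauss_phase_ode b t : phi' b t = - (t / a) * phi b t.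
Proof.
pose F (x : R) := sin (b + x * t) * gauss a x.
pose f (x : R) := t * (cos (b + x * t) * gauss a x) +
  a * - (sin (b + x * t) * x * gauss a x).
have dF (x : R) : is_derive x 1 F (f x).
  have P : is_derive x 1 (fun s : R => b + s * t) t.
    rewrite (_ : (fun s : R => b + s * t) = cst b + t \*: id); last first.
      by apply/funext => y; rewrite !fctE /GRing.scale /= mulrC.
    by apply: is_derive_eq; rewrite add0r /GRing.scale /= mulr1.
  have P' := @is_derive1_comp _ (@sin R) (fun s : R => b + s * t) x _ _
    (is_derive_sin _) P.
  have Q : is_derive x 1 (fun s : R => - (a * (s ^+ 2 / 2))) (- (a * x)).
    rewrite (_ : (fun s : R => _) = - (a / 2) \*: (id ^+ 2 : R -> R)); last first.
      by apply/funext => y; transitivity (- (a / 2) * y ^+ 2); first by field.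
    by apply: is_derive_eq; rewrite /GRing.scale /=; field.
  have Q' := @is_derive1_comp _ (@expR R) (fun s : R => - (a * (s ^+ 2 / 2))) x
    _ _ (is_derive_expR _) Q.
  rewrite (_ : F = (@sin R \o (fun s : R => b + s * t)) *
    (@expR R \o (fun s : R => - (a * (s ^+ 2 / 2))))); last exact/funext.
  by apply: is_derive_eq; rewrite /GRing.scale /= /f /gauss; ring.
have cl : continuous (fun s : R => b + s * t).
  move=> x; apply: cvgD; first exact: cvg_cst.
  by apply: cvgMr_tmp; exact: cvg_id.
have cg : continuous (gauss a).
  move=> x; apply: continuous_comp; last exact: continuous_expR.
  apply: cvgN; apply: cvgMl_tmp; apply: cvgMr_tmp; exact: exprn_continuous.
have cf : continuous f.
  move=> x; apply: cvgD; apply: cvgMl_tmp.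
    apply: cvgM; last exact: cg.
    by apply: continuous_comp; [exact: cl|exact: continuous_cos].
  apply: cvgN; apply: cvgM; last exact: cg.
  apply: cvgM; last exact: cvg_id.
  by apply: continuous_comp; [exact: cl|exact: continuous_sin].
have iN : mu.-integrable setT
    (EFin \o (fun x => - (sin (b + x * t) * x * gauss a x))).
  exact: integrableN (integrable_sin_gauss b t).
have i1 := integrable_EFinZ t (integrable_cos_gauss b t).
have i2 := integrable_EFinZ a iN.
have intf : mu.-integrable setT (EFin \o f) by exact: integrable_EFinD.
have [Fp Fm] : F n.+1%:R @[n --> \oo] --> 0 /\ F (- n.+1%:R) @[n --> \oo] --> 0.
  apply: gauss_cvg0 => x; rewrite normrM [`|gauss a x|]ger0_norm ?expR_ge0//.
  by rewrite ler_piMl ?expR_ge0// ler_norml sin_geN1 sin_le1.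
have := Rintegral_derivative0 dF cf intf Fp Fm.
rewrite RintegralD// RintegralZl//; last exact: integrable_cos_gauss.
rewrite RintegralZl// -/(phi b t) -/(phi' b t) => H.
move/eqP: H; rewrite addrC addr_eq0 => /eqP H.
by apply: (mulfI (lt0r_neq0 a0)); rewrite H; field; rewrite gt_eqF.
Qed.

(** The linear equation phi' = -(t/a) phi makes phi(t) e^(t^2/(2a)) constant,
    equal to its value cos b sqrt(2 pi/a) at t = 0.  The phase b is inert, so
    cosine and sine transforms are covered at once. *)
Lemma Rintegral_cos_gauss b t : \int[mu]_x (cos (b + x * t) * gauss a x) =
  cos b * Num.sqrt (2 * pi / a) * expR (- (t ^+ 2 / a / 2)).
Proof.
pose g (t : R) := t ^+ 2 / a / 2.
pose psi : R -> R := (phi b : R -> R) * (@expR R \o g).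
have dpsi (s : R) : is_derive s 1 psi 0.
  have Q : is_derive s 1 g (s / a).
    rewrite (_ : g = (a^-1 / 2) \*: (id ^+ 2 : R -> R)); last first.
      by apply/funext => y; transitivity (a^-1 / 2 * y ^+ 2); first by rewrite /g; ring.
    by apply: is_derive_eq; rewrite /GRing.scale /=; field; rewrite gt_eqF.
  have Q' := @is_derive1_comp _ (@expR R) g s _ _ (is_derive_expR _) Q.
  have P := is_derive_gauss_phase b s; rewrite gauss_phase_ode in P.
  by apply: is_derive_eq; rewrite /GRing.scale /=; ring.
have H : psi t = psi 0 by exact: is_derive_0_is_cst.
have g0 : g 0 = 0 by rewrite /g expr0n /= !mul0r.
have p0 : phi b 0 = cos b * Num.sqrt (2 * pi / a).
  rewrite -Rintegral_gauss// -RintegralZl//; last exact: integrable_gauss.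
  by apply: eq_Rintegral => x _; rewrite mulr0 addr0.
move: H; rewrite /psi !fctE /= g0 expR0 mulr1 p0 => <-.
by rewrite -[RHS]mulrA -expRD subrr expR0 mulr1.
Qed.

End gauss_fourier.

(** * Gaussians on R^d *)

(** Lebesgue measure on R^(d+1) is a pushforward of the product of the line with
    R^d, so integrals over R^d are computed one coordinate at a time. *)
Section integral_Rd.
Local Open Scope ereal_scope.
Variable R : realType.

Lemma integral_Rd0 (f : Rd R 0 -> \bar R) : measurable_fun setT f ->
  \int[lebesgue_Rd R 0]_x f x = f [tuple].
Proof. by move=> mf; rewrite (integral_dirac _ measurableT mf) diracT mul1e. Qed.

Lemma ge0_integral_RdS d (f : Rd R d.+1 -> \bar R) :
  measurable_fun setT f -> (forall x, 0 <= f x) ->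
  \int[lebesgue_Rd R d.+1]_x f x =
  \int[@lebesgue_measure R]_t \int[lebesgue_Rd R d]_x f (tuple_cons (t, x)).
Proof.
move=> mf f0; have mc := @measurable_tuple_cons R d.
have := @ge0_integral_pushforward _ _ _ _ _ _ mc
    (@lebesgue_measure R \x lebesgue_Rd R d)
  setT f measurableT mf (fun x _ => f0 x).
rewrite preimage_setT => H; rewrite [LHS]H fubini_tonelli1//.
  exact: measurableT_comp.
by move=> x; exact: f0.
Qed.

Lemma integral_RdS d (f : Rd R d.+1 -> \bar R) :
  (lebesgue_Rd R d.+1).-integrable setT f ->
  \int[lebesgue_Rd R d.+1]_x f x =
  \int[@lebesgue_measure R]_t \int[lebesgue_Rd R d]_x f (tuple_cons (t, x)).
Proof.
move=> intf; have mf := measurable_int _ intf.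
have mc := @measurable_tuple_cons R d.
have intfc : (@lebesgue_measure R \x lebesgue_Rd R d).-integrable setT
    (f \o @tuple_cons R d).
  apply/integrableP; split; first exact: measurableT_comp.
  have /integrableP[_] := intf.
  have maf : measurable_fun setT (fun x => `|f x|) by exact: measurableT_comp.
  have := @ge0_integral_pushforward _ _ _ _ _ _ mc
    (@lebesgue_measure R \x lebesgue_Rd R d)
    setT _ measurableT maf (fun x _ => abse_ge0 (f x)).
  by rewrite preimage_setT => <-.
have := @integral_pushforward _ _ _ _ _ _ mc (@lebesgue_measure R \x lebesgue_Rd R d)
  setT f mf.
rewrite preimage_setT => /(_ intfc measurableT) H; rewrite [LHS]H.
by rewrite -integral12_prod_meas1.
Qed.

End integral_Rd.

Section gaussian_Rd.
Variables (R : realType) (a : R).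
Hypothesis a0 : 0 < a.

Definition gauss_Rd d (x : Rd R d) : R := expR (- (a * (dotp x x / 2))).

Lemma dotp_cons d (t u : R) (x y : Rd R d) :
  dotp (tuple_cons (t, x)) (tuple_cons (u, y)) = t * u + dotp x y.
Proof.
rewrite /dotp big_ord_recl; congr (_ * _ + _).
by apply: eq_bigr => i _; rewrite !tnthS.
Qed.

Lemma dotp0 (x y : Rd R 0) : dotp x y = 0.
Proof. by rewrite /dotp big_ord0. Qed.

Lemma measurable_dotp d (y : Rd R d) : measurable_fun setT (fun x : Rd R d => dotp x y).
Proof.
apply: measurable_sum => i; apply: measurable_funM => //.
exact: measurable_tnth.
Qed.

Lemma measurable_dotp_diag d : measurable_fun setT (fun x : Rd R d => dotp x x).
Proof.
apply: measurable_sum => i.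
by apply: measurable_funM; exact: measurable_tnth.
Qed.

Lemma measurable_gauss_Rd d : measurable_fun setT (@gauss_Rd d).
Proof.
apply: measurableT_comp => //; apply: measurableT_comp => //.
apply: measurable_funM => //; apply: measurable_funM => //; exact: measurable_dotp_diag.
Qed.

Lemma gauss_Rd_cons d (t : R) (x : Rd R d) :
  gauss_Rd (tuple_cons (t, x)) = gauss a t * gauss_Rd x.
Proof.
by rewrite /gauss_Rd dotp_cons mulrDl mulrDr opprD expRD -expr2.
Qed.

Lemma integral_gauss_Rd d :
  (\int[lebesgue_Rd R d]_x (gauss_Rd x)%:E)%E = (Num.sqrt (2 * pi / a) ^+ d)%:E.
Proof.
have mg k : measurable_fun setT (fun x : Rd R k => (gauss_Rd x)%:E).
  by apply/measurable_EFinP; exact: measurable_gauss_Rd.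
elim: d => [|d IH].
  by rewrite integral_Rd0// /gauss_Rd dotp0 mul0r mulr0 oppr0 expR0.
rewrite ge0_integral_RdS//; last by move=> x; rewrite lee_fin expR_ge0.
under eq_integral => t _.
  under eq_integral do rewrite gauss_Rd_cons EFinM.
  rewrite ge0_integralZl//; last 3 first.
  - by apply/measurable_EFinP; exact: measurable_gauss_Rd.
  - by move=> y _; rewrite lee_fin expR_ge0.
  - by rewrite lee_fin expR_ge0.
  rewrite IH muleC.
  over.
rewrite /= ge0_integralZl//; last 2 first.
- exact: (measurable_int _ (integrable_gauss a0)).
- by move=> y _; rewrite lee_fin expR_ge0.
rewrite exprSr EFinM; congr (_ * _)%E.
rewrite -(Rintegral_gauss a0) /Rintegral fineK//.
exact: integrable_fin_num (integrable_gauss a0).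
Qed.

Lemma integrable_gauss_Rd d :
  (lebesgue_Rd R d).-integrable setT (fun x : Rd R d => (gauss_Rd x)%:E).
Proof.
apply/integrableP; split; first by apply/measurable_EFinP; exact: measurable_gauss_Rd.
under eq_integral do rewrite /= ger0_norm ?expR_ge0//.
by rewrite integral_gauss_Rd ltry.
Qed.

Lemma integrable_cos_gauss_Rd d (b : R) (y : Rd R d) :
  (lebesgue_Rd R d).-integrable setT (fun x => (cos (b + dotp x y) * gauss_Rd x)%:E).
Proof.
apply: (le_integrable _ _ _ (integrable_gauss_Rd d)) => //.
  apply/measurable_EFinP; apply: measurable_funM; last exact: measurable_gauss_Rd.
  apply: measurableT_comp; first exact: continuous_measurable_fun (@continuous_cos R).
  by apply: measurable_funD => //; exact: measurable_dotp.
move=> x _ /=; rewrite lee_fin normrM [`|gauss_Rd x|]ger0_norm ?expR_ge0//.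
by rewrite ler_piMl ?expR_ge0// ler_norml cos_geN1 cos_le1.
Qed.

(** The phase makes the induction on d work: integrating out the last d
    coordinates with the first one frozen at t only shifts the phase to b + t u,
    u being the first coordinate of y, so no addition formula is needed. *)
Lemma integral_cos_gauss_Rd d (b : R) (y : Rd R d) :
  (\int[lebesgue_Rd R d]_x (cos (b + dotp x y) * gauss_Rd x)%:E)%E =
  (cos b * Num.sqrt (2 * pi / a) ^+ d * expR (- (dotp y y / a / 2)))%:E.
Proof.
elim: d b y => [|d IH] b y.
  rewrite integral_Rd0//; last by have /measurable_int := integrable_cos_gauss_Rd b y.
  by rewrite /gauss_Rd !dotp0 addr0 !mul0r mulr0 oppr0 expR0 expr0 !mulr1.
rewrite integral_RdS; last exact: integrable_cos_gauss_Rd.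
have [u [z ->]] : exists u z, y = tuple_cons (u, z).
  exists (thead y), [tuple of behead y]; apply: val_inj => /=.
  by case: y => -[].
under eq_integral => t _.
  under eq_integral do rewrite dotp_cons gauss_Rd_cons addrA mulrCA EFinM.
  rewrite integralZl//; last exact: integrable_cos_gauss_Rd.
  rewrite IH -EFinM.
  over.
rewrite dotp_cons /=.
transitivity (\int[@lebesgue_measure R]_t
   ((Num.sqrt (2 * pi / a) ^+ d * expR (- (dotp z z / a / 2)))%:E *
    (cos (b + t * u) * gauss a t)%:E))%E.
  by apply: eq_integral => t _; rewrite -EFinM; congr EFin; ring.
rewrite integralZl//; last exact: integrable_cos_gauss.
have -> : (\int[@lebesgue_measure R]_t (cos (b + t * u) * gauss a t)%:E)%E =
    (cos b * Num.sqrt (2 * pi / a) * expR (- (u ^+ 2 / a / 2)))%:E.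
  rewrite -Rintegral_cos_gauss// /Rintegral fineK//.
  exact: integrable_fin_num (integrable_cos_gauss a0 b u).
rewrite -EFinM [Num.sqrt _ ^+ d.+1]exprS; congr EFin.
have -> : - ((u * u + dotp z z) / a / 2) =
  - (u ^+ 2 / a / 2) + - (dotp z z / a / 2) by ring.
rewrite expRD; ring.
Qed.

End gaussian_Rd.

(** * The Fourier transform of f_delta^alpha - 1 *)

(** How the vanishing truncation error is discarded in the final estimates. *)
Lemma le_geometric (R : realType) (x y K q : R) (n0 : nat) : 0 <= q -> q < 1 ->
  (forall n, (n0 <= n)%N -> x <= y + K * q ^+ n) -> x <= y.
Proof.
move=> q0 q1 H.
have C : (fun n => y + K * q ^+ n) @ \oo --> y.
  rewrite -[X in _ --> X]addr0 -[X in _ --> _ + X](mulr0 K).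
  apply: cvgD; first exact: cvg_cst.
  by apply: cvgMl_tmp; apply: cvg_expr; rewrite ger0_norm.
rewrite -(cvg_lim _ C)//; apply: limr_ge; first by apply/cvg_ex; exists y.
by near=> n; apply: H; near: n; exact: nbhs_infty_ge.
Unshelve. all: by end_near. Qed.

Lemma enorm_sqr (R : realType) d (x : Rd R d) : enorm x ^+ 2 = dotp x x.
Proof. by rewrite /enorm sqr_sqrtr// sumr_ge0// => i _; rewrite -expr2 sqr_ge0. Qed.

Lemma sqrt_exprn_powR (R : realType) (u : R) d : 0 <= u ->
  Num.sqrt u ^+ d = u `^ (d%:R / 2).
Proof.
by move=> u0; rewrite -powR12_sqrt// -powR_mulrn ?powR_ge0// -powRrM mulrC.
Qed.

(** Below, [z x] is the argument of the binomial series, [w] the oscillating factor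
    with phase b, and [S n] minus the nonconstant part of the n-th Taylor
    polynomial, so that [g] + [S n] is minus the truncation error. *)
Section fourier_approx.
Variables (R : realType) (d : nat) (a delta b : R) (xi : Rd R d).
Hypotheses (a0 : 0 < a) (a1 : a < 1) (delta0 : 0 < delta).
Let mu := lebesgue_Rd R d.
Let q := expR (- delta).
Let z (x : Rd R d) := q * gauss_Rd 1 x.
Let w (x : Rd R d) := cos (b + dotp x xi).
Let g (x : Rd R d) := fdelta delta x `^ a - 1.
Let S n (x : Rd R d) := \sum_(k < n) binom_coef a k * z x ^+ k.+1.

Let q0 : 0 < q. Proof. exact: expR_gt0. Qed.
Let q1 : q < 1. Proof. by rewrite -expR0 ltr_expR oppr_lt0. Qed.

Let fdeltaE x : fdelta delta x = 1 - z x.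
Proof. by rewrite /fdelta enorm_sqr /z /gauss_Rd mul1r. Qed.

Let gauss01 (x : Rd R d) : 0 < gauss_Rd 1 x <= 1.
Proof.
rewrite /gauss_Rd mul1r expR_gt0 /= -[leRHS]expR0 ler_expR oppr_le0 divr_ge0//.
by rewrite -enorm_sqr sqr_ge0.
Qed.

Let z01 x : 0 < z x <= q.
Proof.
have /andP[g0 g1] := gauss01 x.
by rewrite mulr_gt0 //= ler_piMr// ltW.
Qed.

Let zX x k : z x ^+ k = expR (- (k%:R * delta)) * gauss_Rd k%:R x.
Proof.
rewrite exprMn /q /gauss_Rd -!expRM_natl mulrN mul1r; congr (_ * expR _).
by rewrite mulrN.
Qed.

Let w1 x : `|w x| <= 1.
Proof. by rewrite ler_norml cos_geN1 cos_le1. Qed.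

Let mw : measurable_fun setT w.
Proof.
apply: measurableT_comp; first exact: continuous_measurable_fun (@continuous_cos R).
by apply: measurable_funD => //; exact: measurable_dotp.
Qed.

Let mz : measurable_fun setT z.
Proof. by apply: measurable_funM => //; exact: measurable_gauss_Rd. Qed.

Let mg : measurable_fun setT g.
Proof.
apply: measurable_funB => //.
rewrite (_ : (fun x => _) = (@powR R ^~ a) \o (fun x => 1 - z x)); last first.
  by apply/funext => x /=; rewrite fdeltaE.
apply: measurableT_comp => //; exact: measurable_funB.
Qed.

(** One factor z of z^(n+1) is kept as a Gaussian, which is integrable; the other n
    are bounded by e^-delta < 1. *)
Lemma fourier_integrand_error n x :
  `|w x * g x + w x * S n x| <= q ^+ n / (1 - q) * gauss_Rd 1 x.
Proof.
have /andP[z0 zq] := z01 x; have /andP[g0 g1] := gauss01 x.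
have z1 : z x < 1 by exact: le_lt_trans zq q1.
have /andP[r0 r1] := binom_trunc_error n a0 a1 (ltW z0) z1.
have -> : w x * g x + w x * S n x = - (w x * (binom_trunc a n (z x) - (1 - z x) `^ a)).
  by rewrite /g /S /binom_trunc fdeltaE; ring.
rewrite normrN normrM [`|_ - _|]ger0_norm//.
rewrite -[leRHS]mul1r ler_pM//; apply: (le_trans r1).
rewrite exprSr [leRHS]mulrAC; apply: ler_pM.
- by rewrite mulr_ge0 ?exprn_ge0 ?(ltW z0).
- by rewrite invr_ge0 subr_ge0 ltW.
- apply: ler_pM; rewrite ?exprn_ge0 ?(ltW z0)//.
    by rewrite lerXn2r ?nnegrE ?(ltW z0) ?(ltW q0).
  by rewrite /z ler_piMl ?(ltW g0) ?(ltW q1).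
- by rewrite lef_pV2 ?posrE ?subr_gt0// lerD2l lerN2.
Qed.

Let wSE n : (fun x => w x * S n.+1 x) = (fun x => w x * S n x +
   binom_coef a n * expR (- (n.+1%:R * delta)) * (w x * gauss_Rd n.+1%:R x)).
Proof.
by apply/funext => x; rewrite /S big_ord_recr /= zX; ring.
Qed.

Let wS n : mu.-integrable setT (EFin \o (fun x => w x * S n x)) /\
  \int[mu]_x (w x * S n x) = cos b * (2 * pi) `^ (d%:R / 2) *
    gauss_sum a (d%:R / 2) delta (dotp xi xi) n.
Proof.
elim: n => [|n [IH1 IH2]].
  have E : (fun x => w x * S 0 x) = cst 0.
    by apply/funext => x; rewrite /S big_ord0 mulr0.
  rewrite E; split; first exact: integrable0.
  by rewrite Rintegral_cst// mul0r /gauss_sum big_ord0 mulr0.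
have n0 : (0 : R) < n.+1%:R by rewrite ltr0n.
have ig : mu.-integrable setT (EFin \o (fun x => w x * gauss_Rd n.+1%:R x)).
  exact: integrable_cos_gauss_Rd.
rewrite wSE; split; first by apply: integrable_EFinD => //; exact: integrable_EFinZ.
rewrite RintegralD//; last exact: integrable_EFinZ.
rewrite IH2 RintegralZl// {1}/Rintegral integral_cos_gauss_Rd//=.
rewrite [in RHS]/gauss_sum big_ord_recr [RHS]mulrDr; congr (_ + _).
rewrite sqrt_exprn_powR ?divr_ge0 ?mulr_ge0 ?pi_ge0//.
have -> : (2 * pi / n.+1%:R) `^ (d%:R / 2) =
    (2 * pi) `^ (d%:R / 2) * n.+1%:R `^ (- (d%:R / 2)) :> R.
  rewrite powRM ?mulr_ge0 ?pi_ge0 ?invr_ge0//.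
  by rewrite -[n.+1%:R^-1]powR_inv1 ?ler0n// -powRrM mulN1r.
by rewrite /gauss_term /=; ring.
Qed.

Let iw : mu.-integrable setT (EFin \o (fun x => w x * g x)).
Proof.
have ib : mu.-integrable setT (EFin \o (fun x => q ^+ 0 / (1 - q) * gauss_Rd 1 x)).
  by apply: integrable_EFinZ; exact: integrable_gauss_Rd.
apply: (le_integrable _ _ _ ib) => //.
  by apply/measurable_EFinP; exact: measurable_funM.
move=> x _ /=; rewrite lee_fin.
have := fourier_integrand_error 0 x; rewrite /S big_ord0 mulr0 addr0 => /le_trans; apply.
exact: ler_norm.
Qed.

(** Integrating the pointwise error bound exchanges sum and integral up to an
    error geometric in n, which is all that bounds on the limit require. *)
Lemma fourier_approx n :
  `| \int[mu]_x (w x * g x) +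
     cos b * (2 * pi) `^ (d%:R / 2) * gauss_sum a (d%:R / 2) delta (dotp xi xi) n |
  <= Num.sqrt (2 * pi) ^+ d / (1 - q) * q ^+ n.
Proof.
have [iS <-] := wS n.
rewrite -RintegralD//.
have ib : mu.-integrable setT (EFin \o (fun x => q ^+ n / (1 - q) * gauss_Rd 1 x)).
  by apply: integrable_EFinZ; exact: integrable_gauss_Rd.
apply: (le_trans (le_normr_Rintegral _ (integrable_EFinD iw iS))) => //.
apply: (@le_trans _ _ (\int[mu]_x (q ^+ n / (1 - q) * gauss_Rd 1 x))).
  apply: le_Rintegral => //; last by move=> x _; exact: fourier_integrand_error.
  rewrite (_ : EFin \o _ =
    abse \o (EFin \o (fun x => w x * g x + w x * S n x))); last exact/funext.
  exact/integrable_abse/integrable_EFinD.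
rewrite RintegralZl//; last exact: integrable_gauss_Rd.
rewrite /Rintegral integral_gauss_Rd//= divr1 le_eqVlt; apply/orP; left; apply/eqP; ring.
Qed.

End fourier_approx.

Theorem theorem1p1 (R : realType) (d : nat) (d_ge1 : (1 <= d)%N)
    (alpha : R) (alpha_gt0 : 0 < alpha) (alpha_lt1 : alpha < 1)
    (xi0 : R) (xi0_gt0 : 0 < xi0) :
  exists C eta : R, [/\ 1 < C, 0 < eta, eta < 1 &
    forall (delta : R) (xi : Rd R d), 0 < delta ->
      xi0 ^+ 2 <= enorm xi ^+ 2 -> enorm xi ^+ 2 <= eta / delta ->
      let F := fourier (fun x : Rd R d => (fdelta delta x `^ alpha - 1)%:C) xi in
      C^-1 * enorm xi `^ (- (2 * alpha) - d%:R) <= Normc.normc F /\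
      Normc.normc F <= C * enorm xi `^ (- (2 * alpha) - d%:R)].
Proof.
pose h : R := d%:R / 2.
have h0 : 0 <= h by rewrite divr_ge0.
have [c c0 Hc] := gauss_sum_ge alpha_gt0 alpha_lt1 h0 (exprn_gt0 2 xi0_gt0).
have [C C0 HC] := gauss_sum_le alpha_gt0 alpha_lt1 h0.
exists (1 + C + c^-1), 2^-1; split.
- by rewrite -addrA ltrDl addr_gt0// invr_gt0.
- by rewrite invr_gt0.
- by rewrite invf_lt1// ltr1n.
move=> delta xi delta0 xi_ge xi_le F.
have xi2 : 0 < enorm xi ^+ 2 by rewrite (lt_le_trans _ xi_ge)// exprn_gt0.
have e0 : 0 <= enorm xi by exact: sqrtr_ge0.
have pE : enorm xi `^ (- (2 * alpha) - d%:R) = (enorm xi ^+ 2) `^ (- (alpha + h)).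
  by rewrite -(powR_mulrn 2 e0) -powRrM; congr (_ `^ _); rewrite /h; field.
set p := enorm xi `^ _ in pE *.
have p0 : 0 <= p by exact: powR_ge0.
pose q := expR (- delta).
have q0 : 0 <= q by exact: expR_ge0.
have q1 : q < 1 by rewrite -expR0 ltr_expR oppr_lt0.
pose P : R := (2 * pi) `^ h.
have P0 : 0 < P by rewrite powR_gt0// mulr_gt0// pi_gt0.
pose G n := gauss_sum alpha h delta (enorm xi ^+ 2) n.
pose I b := \int[lebesgue_Rd R d]_x (cos (b + dotp x xi) * (fdelta delta x `^ alpha - 1)).
pose K := Num.sqrt (2 * pi) ^+ d / (1 - q).
have HI b n : `|I b + cos b * P * G n| <= K * q ^+ n.
  by rewrite /G enorm_sqr; exact: fourier_approx.
(* The imaginary part is the phase pi/2, as cos (pi/2 + u) = sin (- u). *)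
have FE : F = (P^-1 * I 0) +i* (P^-1 * I (pi / 2)).
  rewrite /F /fourier /Cintegral -/h -/P.
  rewrite (_ : \int[_]_x complex.Re _ = I 0); last first.
    apply: eq_Rintegral => x _.
    by rewrite /= cosN mulr0 subr0 add0r.
  rewrite (_ : \int[_]_x complex.Im _ = I (pi / 2)); last first.
    apply: eq_Rintegral => x _.
    by rewrite /= sinN mulr0 add0r [pi / 2 + _]addrC cosDpihalf.
  by simpc.
(* At phase pi/2 the main term carries the factor cos (pi/2) = 0. *)
have I2 : I (pi / 2) = 0.
  apply/eqP; rewrite -normr_le0.
  apply: (@le_geometric _ _ 0 K q 0 q0 q1) => n _.
  by rewrite add0r; have := HI (pi / 2) n; rewrite cos_pihalf !mul0r addr0.
have J n : `|I 0 + P * G n| <= K * q ^+ n.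
  by have := HI 0 n; rewrite cos0 mul1r.
have FN : Normc.normc F = P^-1 * `|I 0|.
  rewrite FE I2 mulr0 /= expr0n /= addr0 sqrtr_sqr normrM.
  by rewrite gtr0_norm ?invr_gt0.
have G0 n : 0 <= G n by apply: sumr_ge0 => k _; exact: gauss_term_ge0.
have PG0 n : 0 <= P * G n by rewrite mulr_ge0// ltW.
have ci0 : 0 < c^-1 by rewrite invr_gt0.
rewrite FN; split.
- have [n0 Hn0] := Hc delta (enorm xi ^+ 2) delta0 xi_ge xi_le.
  apply: (@le_trans _ _ (c * p)).
    rewrite ler_wpM2r// -[leRHS]invrK lef_pV2 ?posrE ?invr_gt0 ?addr_gt0//.
    by rewrite lerDr addr_ge0// ltW.
  rewrite ler_pdivlMl//.
  apply: (@le_geometric _ _ _ K q n0 q0 q1) => n nn.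
  apply: (@le_trans _ _ (P * G n)); first by rewrite ler_wpM2l ?(ltW P0)// pE Hn0.
  rewrite -[P * G n](addKr (I 0)) (le_trans (ler_norm _))//.
  by rewrite (le_trans (ler_normD _ _))// normrN lerD2l.
- apply: (@le_trans _ _ (C * p)); last first.
    by rewrite ler_wpM2r// addrAC lerDr addr_ge0// ltW.
  rewrite ler_pdivrMl//.
  apply: (@le_geometric _ _ _ K q 0 q0 q1) => n _.
  apply: (@le_trans _ _ (P * G n + K * q ^+ n)); last first.
    by rewrite lerD2r ler_wpM2l ?(ltW P0)// pE HC.
  rewrite -[I 0](addrK (P * G n)) (le_trans (ler_normB _ _))// addrC lerD//.
  by rewrite ger0_norm.
Qed.
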